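(* Consider low-resolution ADCs at both the relay (parameter $\alpha\in(0,1]$) and the destinations (parameter $\theta\in(0,1)$), and let $\tilde R_k$ be the rate of the $k$-th user defined in the context, with all parameters other than $M$ fixed. Then, as $M\to\infty$, $$\tilde R_k\to\frac{\tau_c-2\tau_p}{\tau_c}\log_2\left(1+\frac{\theta}{1-\theta}\right).$$
   Context: $\tilde R_k$ is the (large-antenna approximated) rate of the $k$-th of $K$ users in a relaying system with $M$ relay antennas and low-resolution ADCs at relay (parameter $\alpha$) and destinations (parameter $\theta$). Parameters: $p_S,p_R,p_p>0$, $\tau_c>2\tau_p>0$, $\sigma_{LI}^2\ge0$, $\beta_{SR,i},\beta_{RD,i}>0$, and $\sigma_{SR,i}^2=\frac{\alpha\tau_pp_p\beta_{SR,i}^2}{1+\tau_pp_p\beta_{SR,i}}$, $\sigma_{RD,i}^2=\frac{\alpha\tau_pp_p\beta_{RD,i}^2}{1+\tau_pp_p\beta_{RD,i}}$ for $i=1,\dots,K$. By definition $$\tilde R_k=\frac{\tau_c-2\tau_p}{\tau_c}\log_2\left(1+\frac{\tilde A_k}{\tilde B_k+\tilde C_k+\tilde D_k+\tilde E_k+\tilde F_k+\tilde G_k+\tilde H_k}\right)$$ with - $\tilde A_k=p_SM\sigma_{SR,k}^2\sigma_{RD,k}^2$; - $\tilde B_k=p_S(\beta_{SR,k}\sigma_{RD,k}^2+\beta_{RD,k}\sigma_{SR,k}^2)$; - $\tilde C_k=p_S\sum_{j\ne k}\Big(\sigma_{RD,k}^2\beta_{SR,j}+\frac{\beta_{RD,k}\sigma_{SR,j}^4\sigma_{RD,j}^2}{\sigma_{SR,k}^2\sigma_{RD,k}^2}\Big)$;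 - $\tilde D_k=p_R\sigma_{LI}^2\sigma_{RD,k}^2$; $\tilde E_k=\sigma_{RD,k}^2$; - $\tilde F_k=\frac{1-\alpha}{\alpha}\sigma_{RD,k}^2\big(p_S(\sigma_{SR,k}^2+\sum_{i=1}^K\beta_{SR,i})+p_R\sigma_{LI}^2+1\big)$; - $\tilde G_k=\frac{p_S}{p_R\sigma_{SR,k}^2\sigma_{RD,k}^2}\sum_{i=1}^K\sigma_{SR,i}^4\sigma_{RD,i}^2$; - $\tilde H_k=\frac{1-\theta}{\theta}p_S\Big(M\sigma_{SR,k}^2\sigma_{RD,k}^2+\frac{\sigma_{SR,k}^2\beta_{RD,k}}{\sigma_{RD,k}^2}\sum_{i=1}^K\sigma_{RD,i}^2\Big)+\frac{1-\theta}{\theta}p_S\sigma_{RD,k}^2\Big(\sum_{i=1}^K\beta_{SR,i}+\frac{p_R\sigma_{LI}^2+1}{\alpha p_S}\Big)+\frac{(1-\alpha)(1-\theta)}{\alpha\theta}\sigma_{RD,k}^2p_S\Big(\sigma_{SR,k}^2+\sum_{i=1}^K\beta_{SR,i}\Big)+\frac{(1-\theta)p_S\sum_{i=1}^K\sigma_{SR,i}^4\sigma_{RD,i}^2}{\theta p_R\sigma_{SR,k}^2\sigma_{RD,k}^2}$. *)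

(* Defs.v *)
From HB Require Import structures.
From mathcomp Require Import all_boot all_order all_algebra.
From mathcomp Require Import all_classical all_reals all_analysis.
Set Implicit Arguments.
Unset Strict Implicit.
Unset Printing Implicit Defensive.
Import Order.TTheory GRing.Theory Num.Theory.
Import numFieldNormedType.Exports.
Local Open Scope classical_set_scope.
Local Open Scope ring_scope.

Definition log2 (R : realType) (x : R) : R := ln x / ln 2.

(* Parameters other than the number M of relay antennas: transmit powers p_S,
   p_R (user, relay) and p_p (pilot), lengths tau_c of the coherence interval
   and tau_p of the pilots, ADC parameters alpha (relay) and theta
   (destinations), sigma2_LI = sigma_LI^2, and the large-scale fading
   coefficients of the K users.  No positivity is built into the record. *)
Record relay_params (R : realType) (K : nat) := RelayParams {
  p_S : R;
  p_R : R;
  p_p : R;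
  tau_c : R;
  tau_p : R;
  alpha : R;
  theta : R;
  sigma2_LI : R;
  beta_SR : 'I_K -> R;
  beta_RD : 'I_K -> R
}.

Section Rate.
Variables (R : realType) (K : nat) (s : relay_params R K).

Local Notation pS := (p_S s).
Local Notation pR := (p_R s).
Local Notation pp := (p_p s).
Local Notation tc := (tau_c s).
Local Notation tp := (tau_p s).
Local Notation al := (alpha s).
Local Notation th := (theta s).
Local Notation sLI := (sigma2_LI s).
Local Notation bSR := (beta_SR s).
Local Notation bRD := (beta_RD s).

(* sigma2_SR i and sigma2_RD i are the squares sigma_{SR,i}^2 and
   sigma_{RD,i}^2; a fourth power sigma_{SR,i}^4 is thus sigma2_SR i ^+ 2. *)
Definition sigma2_SR (i : 'I_K) : R :=
  al * tp * pp * bSR i ^+ 2 / (1 + tp * pp * bSR i).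

Definition sigma2_RD (i : 'I_K) : R :=
  al * tp * pp * bRD i ^+ 2 / (1 + tp * pp * bRD i).

Local Notation sSR := sigma2_SR.
Local Notation sRD := sigma2_RD.

Definition rate_A (M : nat) (k : 'I_K) : R :=
  pS * M%:R * sSR k * sRD k.

Definition rate_B (k : 'I_K) : R :=
  pS * (bSR k * sRD k + bRD k * sSR k).

Definition rate_C (k : 'I_K) : R :=
  pS * \sum_(j < K | j != k)
         (sRD k * bSR j + bRD k * sSR j ^+ 2 * sRD j / (sSR k * sRD k)).

Definition rate_D (k : 'I_K) : R := pR * sLI * sRD k.

Definition rate_E (k : 'I_K) : R := sRD k.

Definition rate_F (k : 'I_K) : R :=
  (1 - al) / al * sRD k *
    (pS * (sSR k + \sum_(i < K) bSR i) + pR * sLI + 1).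

Definition rate_G (k : 'I_K) : R :=
  pS / (pR * sSR k * sRD k) * \sum_(i < K) (sSR i ^+ 2 * sRD i).

Definition rate_H (M : nat) (k : 'I_K) : R :=
  (1 - th) / th * pS *
    (M%:R * sSR k * sRD k + sSR k * bRD k / sRD k * \sum_(i < K) sRD i)
  + (1 - th) / th * pS * sRD k *
    (\sum_(i < K) bSR i + (pR * sLI + 1) / (al * pS))
  + (1 - al) * (1 - th) / (al * th) * sRD k * pS *
    (sSR k + \sum_(i < K) bSR i)
  + (1 - th) * pS * (\sum_(i < K) (sSR i ^+ 2 * sRD i)) /
    (th * pR * sSR k * sRD k).

Definition rate (M : nat) (k : 'I_K) : R :=
  (tc - 2 * tp) / tc *
  log2 (1 + rate_A M k /
            (rate_B k + rate_C k + rate_D k + rate_E k + rate_F k + rate_G k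
             + rate_H M k)).

End Rate.

(* Main.v *)
Require Import Defs.
From HB Require Import structures.
From mathcomp Require Import all_boot all_order all_algebra.
From mathcomp Require Import all_classical all_reals all_analysis.
From mathcomp Require Import ring.
Import Order.TTheory GRing.Theory Num.Theory.
Import numFieldNormedType.Exports.
Local Open Scope classical_set_scope.
Local Open Scope ring_scope.

(* Numerator and denominator of the ratio are affine in [M]: with
   [a = p_S * sigma2_SR k * sigma2_RD k], the only growing terms are [a M] in [rate_A] and
   [(1 - theta) / theta * a M] in [rate_H].  The ratio thus tends to the quotient of
   the slopes, [theta / (1 - theta)], and the logarithm is continuous there. *)

Lemma cvg_linear_over_affine (R : realType) (a b c : R) :
  b != 0 -> a * n%:R / (c + b * n%:R) @[n --> \oo] --> a / b.
Proof.
(* Shifting the index to [n.+1] makes it invertible, so numerator and denominator can be divided by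
   it. *)
move=> b0; rewrite -cvg_shiftS.
have -> : (fun n => a * n.+1%:R / (c + b * n.+1%:R)) =
          (fun n => a / (c * n.+1%:R^-1 + b)).
  apply/funext => n; have n0 : n.+1%:R != 0 :> R by rewrite pnatr_eq0.
  have -> : c * n.+1%:R^-1 + b = (c + b * n.+1%:R) / n.+1%:R by field.
  (* If the denominator vanishes, both sides are 0 because [0^-1 = 0], so the equality holds at
     every [n]. *)
  by rewrite invf_div mulrA.
apply: cvgM; first exact: cvg_cst.
apply: cvgV => //; rewrite -[X in _ --> X]add0r -[X in X + b](mulr0 c).
apply: cvgD; last exact: cvg_cst.
by apply: cvgM; [exact: cvg_cst|exact: cvg_harmonic].
Qed.

(** Setting [M] to 0 kills the single term that grows, so [rate_H s 0 k] serves as the intercept. *)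
Lemma rate_H_affine (R : realType) (K : nat) (s : relay_params R K) (M : nat)
    (k : 'I_K) :
  rate_H s M k = rate_H s 0 k +
    (1 - theta s) / theta s * (p_S s * sigma2_SR s k * sigma2_RD s k) * M%:R.
Proof. by rewrite /rate_H; ring. Qed.

Lemma sigma2_SR_gt0 (R : realType) (K : nat) (s : relay_params R K) (k : 'I_K) :
  0 < p_p s -> 0 < tau_p s -> 0 < alpha s -> 0 < beta_SR s k ->
  0 < sigma2_SR s k.
Proof.
by move=> *; rewrite divr_gt0 ?addr_gt0 ?mulr_gt0 ?exprn_gt0 ?ltr01.
Qed.

Lemma sigma2_RD_gt0 (R : realType) (K : nat) (s : relay_params R K) (k : 'I_K) :
  0 < p_p s -> 0 < tau_p s -> 0 < alpha s -> 0 < beta_RD s k ->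
  0 < sigma2_RD s k.
Proof.
by move=> *; rewrite divr_gt0 ?addr_gt0 ?mulr_gt0 ?exprn_gt0 ?ltr01.
Qed.

Theorem corollary1 (R : realType) (K : nat) (s : relay_params R K)
  (pS_gt0 : 0 < p_S s) (pR_gt0 : 0 < p_R s) (pp_gt0 : 0 < p_p s)
  (tau_p_gt0 : 0 < 2 * tau_p s) (tau_c_gt : 2 * tau_p s < tau_c s)
  (sigma2_LI_ge0 : 0 <= sigma2_LI s)
  (beta_SR_gt0 : forall i : 'I_K, 0 < beta_SR s i)
  (beta_RD_gt0 : forall i : 'I_K, 0 < beta_RD s i)
  (alpha_gt0 : 0 < alpha s) (alpha_le1 : alpha s <= 1)
  (theta_gt0 : 0 < theta s) (theta_lt1 : theta s < 1)
  (k : 'I_K) :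
  rate s M k @[M --> \oo] -->
    (tau_c s - 2 * tau_p s) / tau_c s *
    log2 (1 + theta s / (1 - theta s)).
Proof.
have tp0 : 0 < tau_p s by rewrite pmulr_rgt0 in tau_p_gt0.
have sSR0 : 0 < sigma2_SR s k by exact: sigma2_SR_gt0.
have sRD0 : 0 < sigma2_RD s k by exact: sigma2_RD_gt0.
have th1 : 0 < 1 - theta s by rewrite subr_gt0.
set a := p_S s * sigma2_SR s k * sigma2_RD s k.
have a0 : 0 < a by exact: mulr_gt0 (mulr_gt0 pS_gt0 sSR0) sRD0.
set b := (1 - theta s) / theta s * a.
have b0 : 0 < b by rewrite mulr_gt0 ?divr_gt0.
pose c := rate_B s k + rate_C s k + rate_D s k + rate_E s k + rate_F s k +
  rate_G s k + rate_H s 0 k.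
have -> : theta s / (1 - theta s) = a / b.
  by rewrite /b; field; rewrite ?gt_eqF.
apply: cvgM; first exact: cvg_cst.
(* The constant factor split off here is [(ln 2)^-1], from the definition of [log2]. *)
apply: cvgM; last exact: cvg_cst.
(* Continuity of [ln] is available only at positive points. *)
have pos : 0 < 1 + a / b by rewrite addr_gt0 ?divr_gt0.
apply: (continuous_cvg _ (continuous_ln pos)).
apply: cvgD; first exact: cvg_cst.
have -> : (fun M => rate_A s M k / (rate_B s k + rate_C s k + rate_D s k +
    rate_E s k + rate_F s k + rate_G s k + rate_H s M k)) =
    (fun M => a * M%:R / (c + b * M%:R)).
  (* Once reassociated, the denominator is [c + b * M%:R] by unfolding, so only the numerators
     remain to be compared. *)
  apply/funext => M; rewrite rate_H_affine addrA; congr (_ / _).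
  by rewrite /rate_A /a; ring.
by apply: cvg_linear_over_affine; rewrite gt_eqF.
Qed.
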